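(* Let $d\ge2$ and let $\Delta^{d-1}=\{p\in\mathbb{R}^d_+:p_1+\cdots+p_d=1\}$. The set of alternatives $X\equiv\Delta^{d-1}$, endowed with the Euclidean topology, is locally compact, separable and completely metrizable, and the class $\mathcal{P}$ of all nonconstant expected utility preferences on $\Delta^{d-1}$ is a closed set (in the closed convergence topology) of locally strict preferences.
   Context: An expected utility preference is a relation $\succeq$ on $\Delta^{d-1}$ for which there is $v\in\mathbb{R}^d$ with $p\succeq p'$ iff $v\cdot p\ge v\cdot p'$. It is nonconstant if $p\succ p'$ for at least one pair $p,p'\in\Delta^{d-1}$ (equivalently $v_i\ne v_j$ for some $i,j$). A preference on $X$ is a complete binary relation on $X$ that is closed as a subset of $X\times X$. $x\succ y$ means $x\succeq y$ and not $y\succeq x$. $\succeq$ is locally strict if for all $x\succeq y$ and every neighborhood $V$ of $(x,y)$ in $X\times X$ there is $(x',y')\in V$ with $x'\succ y'$. Closed convergence: $\succeq_n\to\succeq^*$ means (1) for all $x^*\succeq^* y^*$ there are $(x_n,y_n)\to(x^*,y^* )$ with $x_n\succeq_n y_n$ for all $n$; and (2) for every subsequence $\{\succeq_{n_k}\}_k$ and every limit $(x^*,y^* )$ of pairs with $x_{n_k}\succeq_{n_k}y_{n_k}$ for all $k$, $x^*\succeq^*y^*$. For locally compact, separable, completely metrizable $X$ this is convergence in the metrizable closed convergence topology on continuous binary relations (closed subsets of $X\times X$). *)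

(* Defs.v *)
From HB Require Import structures.
From mathcomp Require Import all_boot all_order all_algebra.
From mathcomp Require Import all_classical all_reals all_analysis.

Set Implicit Arguments.
Unset Strict Implicit.
Unset Printing Implicit Defensive.

Import Order.TTheory GRing.Theory Num.Theory.
Import numFieldNormedType.Exports.

Local Open Scope classical_set_scope.
Local Open Scope ring_scope.

(** A binary relation on [T] is a [B : set (T * T)]; [B (x, y)] reads "x is
    weakly preferred to y". *)

Section Preferences.
Context {T : topologicalType}.
Implicit Type B : set (T * T).

Definition strict B (x y : T) := B (x, y) /\ ~ B (y, x).

Definition preference B := (forall x y, B (x, y) \/ B (y, x)) /\ closed B.

Definition locally_strict B :=
  forall x y, B (x, y) -> forall V : set (T * T), nbhs (x, y) V ->
    exists x' y', V (x', y') /\ strict B x' y'.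

Definition closed_convergence (B_ : nat -> set (T * T)) B :=
  (forall z : T * T, B z ->
     exists z_ : nat -> T * T, (forall n, B_ n (z_ n)) /\ z_ @ \oo --> z) /\
  (forall k : nat -> nat, {homo k : m n / (m < n)%N} ->
     forall (z_ : nat -> T * T) (z : T * T),
       (forall n, B_ (k n) (z_ n)) -> z_ @ \oo --> z -> B z).

End Preferences.

(** Continuous binary relations. *)
Record closed_relation (T : topologicalType) := ClosedRelation {
  relation_of :> set (T * T);
  closed_relation_of : closed relation_of }.

HB.instance Definition _ (T : topologicalType) :=
  gen_eqMixin (closed_relation T).
HB.instance Definition _ (T : topologicalType) :=
  gen_choiceMixin (closed_relation T).

(** The closed convergence topology (also called the Fell topology) is generated
    by the sets of closed relations meeting a given open set and the sets of
    closed relations missing a given compact set. When [T] is locally compact,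
    separable and metrizable it is metrizable, and convergence of sequences of
    nonempty relations in it is [closed_convergence]. *)
Definition closed_convergence_subbase (T : topologicalType) :
    set (set (closed_relation T)) :=
  [set [set B : closed_relation T | B `&` U !=set0] | U in @open (T * T)%type]
  `|`
  [set [set B : closed_relation T | B `&` K = set0] | K in @compact (T * T)%type].

HB.instance Definition _ (T : topologicalType) :=
  isSubBaseTopological.Build (closed_relation T)
    (@closed_convergence_subbase T) id.

Definition separable (T : topologicalType) :=
  exists2 S : set T, countable S & dense S.

Definition completely_metrizable (R : realType) (T : topologicalType) :=
  exists (M : metricType R) (f : T -> M) (g : M -> T),
    [/\ cancel f g, cancel g f, continuous f, continuous g &
        forall F : set_system M, ProperFilter F -> cauchy F ->
          exists l : M, F --> l].

Definition simplex_set (R : realType) (d : nat) : set 'rV[R]_d :=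
  [set p | (forall i, 0 <= p 0 i) /\ \sum_i p 0 i = 1].

(** The topology on [set_type A] is the one induced by the inclusion of [A]; that
    on ['rV[R]_d] is the product topology, i.e. the Euclidean one. *)
Definition simplex (R : realType) (d : nat) : topologicalType :=
  set_type (@simplex_set R d).

Section ExpectedUtility.
Context {R : realType} {d : nat}.
Implicit Type B : set (simplex R d * simplex R d).

Definition expected_value (v : 'rV[R]_d) (p : simplex R d) : R :=
  \sum_i v 0 i * (set_val p) 0 i.

Definition expected_utility B :=
  exists v : 'rV[R]_d, forall p p',
    B (p, p') <-> expected_value v p' <= expected_value v p.

Definition nonconstant B := exists p p', strict B p p'.

End ExpectedUtility.

Definition nonconstant_EU (R : realType) (d : nat) :
    set (set (simplex R d * simplex R d)) :=
  [set B | expected_utility B /\ nonconstant B].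

(* Main.v *)
Require Import Defs.
From HB Require Import structures.
From mathcomp Require Import all_boot all_order all_algebra.
From mathcomp Require Import all_classical all_reals all_analysis.
From mathcomp Require Import finmap ring lra.
Import Order.TTheory GRing.Theory Num.Theory.
Import numFieldNormedType.Exports.
Local Open Scope classical_set_scope.
Local Open Scope ring_scope.

(** A nonconstant expected utility preference has a representing vector with
    coordinates in [[0, 1]] and two coordinates at distance at least 1; these
    vectors form a compact set, so along any filter of such preferences their
    representing vectors have a cluster point [v] in it. Joint continuity of
    [(v, p) |-> v . p] shows that a limit [B] of the preferences is contained in
    the preference represented by [v], and that every pair ranked strictly by
    [v] belongs to [B]. Moving the two alternatives of a pair slightly towards a
    better and a worse vertex of the simplex makes a weak ranking strict; hence
    the preference of [v] is locally strict, and contained in [B] because [B] is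
    closed. *)

(** * The metric on a subset of a normed space *)

Section SubsetMetric.
Context {R : realType} {V : normedModType R} (A : set V).

Let dist (x y : A) : R := `|set_val x - set_val y|.

Let dist_ge0 x y : 0 <= dist x y. Proof. exact: normr_ge0. Qed.

Let dist_positivity x y : dist x y = 0 -> x = y.
Proof. by move=> /normr0_eq0/subr0_eq /val_inj. Qed.

Let ballEdist (x : A) e : ball x e = [set y | dist x y < e].
Proof. by rewrite -initial_ballE -ball_normE. Qed.

(** Built over the induced pseudometric, so the topology remains the subspace topology. *)
HB.instance Definition _ := PseudoMetric_isMetric.Build R (set_type A)
  dist_ge0 dist_positivity ballEdist.

End SubsetMetric.

(** * Consequences of compactness *)

Lemma compact_set_type {T : topologicalType} {A : set T} :
  compact A -> compact [set: A].
Proof.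
move=> cA F FF _.
have [|p [Ap clp]] := cA (set_val @ F) _ _.
  by apply: (@filterS _ F _ setT) filterT => x _; exact: set_valP.
exists (SigSub (mem_set Ap)); split => // U W FU.
rewrite nbhsE => -[_ [[W' oW' <-] W'p] W'W].
have FvU : (set_val @ F) (set_val @` U).
  by apply: (@filterS _ F _ U) FU => x Ux; exists x.
have [_ [[x Ux <-] W'x]] := clp _ _ FvU (open_nbhs_nbhs (conj oW' W'p)).
by exists x; split => //; exact: W'W.
Qed.

Lemma compact_locally_compact {T : topologicalType} :
  compact [set: T] -> locally_compact [set: T].
Proof.
move=> cT x _; rewrite withinET; exists setT; first exact: filterT.
by split => //; exact: closedT.
Qed.

Lemma second_countable_separable {T : topologicalType} (x0 : T) :
  @second_countable T -> separable T.
Proof.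
(* One point per basic set; [x0] stands in when the set is empty. *)
move=> -[B cB [oB basisB]]; exists [set xget x0 U | U in B].
  exact: card_le_trans (card_image_le _ _) cB.
move=> O [x Ox] oO.
have [U [BU Ux UO]] := basisB x _ (open_nbhs_nbhs (conj oO Ox)).
exists (xget x0 U); split; last by exists U.
by apply: UO; apply: xgetPex; exists x.
Qed.

Lemma compact_separable {R : realType} {T : pseudoMetricType R} (x0 : T) :
  compact [set: T] -> separable T.
Proof.
move=> cT; apply: (second_countable_separable x0).
pose pT : pseudoPMetricType R := HB.pack T (isPointed.Build T x0).
exact: (@compact_second_countable R pT).
Qed.

(** A cluster point [x] of a Cauchy filter is its limit: [e] splits into [e / 2] from [x] to [w] and
    twice [e / 4] through the centre [z]. *)
Lemma compact_completely_metrizable {R : realType} {T : metricType R} :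
  compact [set: T] -> completely_metrizable R T.
Proof.
move=> cT; exists T, id, id; split=> // [||F FF cF].
- by move=> x; exact: cvg_id.
- by move=> x; exact: cvg_id.
have [x [_ clx]] := cT F FF (@filterT _ F _); exists x; apply/cvg_ballP => e e0.
have e2 : 0 < e / 2 by rewrite divr_gt0.
have [z Fz] := (iffLR (cauchyP F)) cF _ (divr_gt0 e2 (ltr0Sn R 1)).
have [w [zw xw]] := clx _ _ Fz (nbhsx_ballx x _ e2).
apply: filterS Fz => y zy; rewrite [e]splitr; apply: ball_triangle xw _.
by rewrite [e / 2]splitr; apply: ball_triangle (ball_sym zw) zy.
Qed.

(** * Compactness of the simplex *)

Lemma sum_continuous {R : realType} {T : topologicalType} {I : finType}
    (F : I -> T -> R) :
  (forall i, continuous (F i)) -> continuous (fun x => \sum_i F i x).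
Proof.
move=> cF.
apply: (@continuous_big R I +%R 0 xpredT _ T (index_enum I) F) => [z|i _].
  exact: add_continuous.
exact: cF.
Qed.

Lemma compact_simplex_set (R : realType) (d : nat) : compact (@simplex_set R d).
Proof.
pose box := [set v : 'rV[R]_d | forall i, `[0, 1]%classic (v ord0 i)].
have cbox : compact box.
  apply: (@rV_compact R d (fun=> `[0, 1]%classic)) => _.
  exact: segment_compact.
apply: subclosed_compact cbox _.
  have -> : @simplex_set R d =
      \bigcap_(i in [set: 'I_d]) (fun p => p 0 i) @^-1` [set x | 0 <= x] `&`
      (fun p => \sum_i p 0 i) @^-1` [set 1].
    by apply/seteqP; split=> p [p0 p1]; split=> // i; [move=> _|]; exact: p0.
  apply: closedI.
    apply: closed_bigI => i _; apply: preimage_closed; last exact: closed_ge.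
    by move=> p _; exact: coord_continuous.
  apply: preimage_closed; last exact: closed_eq.
  by move=> p _; apply: sum_continuous => i; exact: coord_continuous.
move=> p [p0 p1] i; rewrite /= in_itv/= p0/= -p1 (bigD1 i)//= lerDl.
by rewrite sumr_ge0.
Qed.

(** * Expected values: convexity, continuity, perturbation *)

Section ExpectedValue.
Context {R : realType} {d : nat}.
Implicit Types (v : 'rV[R]_d) (x y : simplex R d).

Lemma simplex_ge0 x i : 0 <= (set_val x) 0 i.
Proof. by have [] := set_valP x. Qed.

Lemma simplex_sum1 x : \sum_i (set_val x) 0 i = 1.
Proof. by have [] := set_valP x. Qed.

(** Convexity: the point is [(1 - t) x + t e_k], written as a displacement so that its distance to
    [x] can be read off. *)
Lemma simplex_shift x (k : 'I_d) {t : R} : 0 <= t <= 1 ->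
  exists x' : simplex R d,
    set_val x' = set_val x + t *: (delta_mx 0 k - set_val x).
Proof.
move=> /andP[t0 t1].
suff Sx' : simplex_set (set_val x + t *: (delta_mx 0 k - set_val x)).
  by exists (SigSub (mem_set Sx')).
split=> [i|].
  rewrite !mxE mulrBr addrCA -[X in _ + (X - _)]mul1r -mulrBl addr_ge0//.
    by rewrite mulr_ge0.
  by rewrite mulr_ge0 ?subr_ge0// simplex_ge0.
under eq_bigr do rewrite !mxE eqxx/=.
rewrite big_split/= -mulr_sumr sumrB simplex_sum1 (bigD1 k)//= eqxx big1.
  by rewrite addr0 subrr mulr0 addr0.
by move=> i /negPf ->.
Qed.

Lemma simplex_vertex (k : 'I_d) :
  exists x : simplex R d, forall v, expected_value v x = v 0 k.
Proof.
suff Sk : simplex_set (delta_mx 0 k : 'rV[R]_d).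
  exists (SigSub (mem_set Sk)) => v.
  rewrite /expected_value set_valE/= (bigD1 k)//= big1 ?addr0 ?mxE ?eqxx ?mulr1//.
  by move=> i /negPf ik; rewrite mxE ik andbF mulr0.
split=> [i|]; first by rewrite mxE.
rewrite (bigD1 k)//= big1 ?addr0 ?mxE ?eqxx//.
by move=> i /negPf ik; rewrite mxE ik andbF.
Qed.

Lemma expected_value_shift v {x x' k t} :
  set_val x' = set_val x + t *: (delta_mx 0 k - set_val x) ->
  expected_value v x' = (1 - t) * expected_value v x + t * v 0 k.
Proof.
rewrite /expected_value => ->.
rewrite mulr_sumr [v 0 k](_ : _ = \sum_i v 0 i * (i == k)%:R); last first.
  rewrite (bigD1 k)//= eqxx mulr1 big1 ?addr0// => i /negPf ->.
  by rewrite mulr0.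
rewrite mulr_sumr -big_split/=; apply: eq_bigr => i _.
by rewrite !mxE eqxx/=; ring.
Qed.

Lemma expected_value_continuous :
  continuous (fun vx : 'rV[R]_d * simplex R d => expected_value vx.1 vx.2).
Proof.
apply: sum_continuous => i vx.
apply: (@continuousM _ _ (fun vx : 'rV[R]_d * simplex R d => vx.1 0 i)
  (fun vx => (set_val vx.2) 0 i)).
  apply: (@continuous_comp _ _ _ fst (fun v : 'rV[R]_d => v 0 i)).
    exact: cvg_fst.
  exact: coord_continuous.
apply: (@continuous_comp _ _ _ (set_val \o snd) (fun v : 'rV[R]_d => v 0 i)).
  apply: (@continuous_comp _ _ _ snd set_val); first exact: cvg_snd.
  exact: initial_continuous.
exact: coord_continuous.
Qed.

(** Strict inequality is open by joint continuity. [W] and [U] are kept apart because a cluster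
    point of vectors is tested against [W] alone. *)
Lemma near_expected_value_lt {v x y} :
  expected_value v x < expected_value v y ->
  exists (W : set 'rV[R]_d) (U : set (simplex R d * simplex R d)),
    [/\ nbhs v W, nbhs (x, y) U & forall w z, W w -> U z ->
      expected_value w z.1 < expected_value w z.2].
Proof.
rewrite -subr_gt0 => vxy.
pose gap (p : 'rV[R]_d * (simplex R d * simplex R d)) :=
  expected_value p.1 p.2.2 - expected_value p.1 p.2.1.
have gapc : gap p @[p --> (v, (x, y))] --> gap (v, (x, y)).
  apply: cvgB.
    apply: (continuous2_cvg _ (expected_value_continuous (v, y))).
      exact: cvg_fst.
    by apply: (@cvg_comp _ _ _ snd snd _ (nbhs (x, y))); exact: cvg_snd.
  apply: (continuous2_cvg _ (expected_value_continuous (v, x))).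
    exact: cvg_fst.
  apply: (@cvg_comp _ _ _ snd fst _ (nbhs (x, y))); first exact: cvg_snd.
  exact: cvg_fst.
have [[W U] [/= nW nU] WU] := cvgr_gt _ gapc _ vxy.
exists W, U; split=> // w z Ww Uz; rewrite -subr_gt0.
exact: (WU (w, z)).
Qed.

(** Moving [x] towards vertex [j] and [y] towards vertex [i] by the same [t] turns the utility gap
    into [1 - t] times the old one, which is nonnegative, plus [t * (v 0 j - v 0 i) > 0]. *)
Lemma expected_value_lt_perturb {v x y}
    {V : set (simplex R d * simplex R d)} {i j} :
  v 0 i < v 0 j -> expected_value v y <= expected_value v x ->
  nbhs (x, y) V ->
  exists x' y', V (x', y') /\ expected_value v y' < expected_value v x'.
Proof.
move=> vij vyx.
pose X := set_type (@simplex_set R d).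
move=> /(@nbhs_ballP R (X * X)%type)[e /= e0 eV].
pose a := `|delta_mx 0 j - set_val x|.
pose b := `|delta_mx 0 i - set_val y|.
(* [m] exceeds [e], [a] and [b], so [t < 1] and the displacements [t * a] and [t * b] are below
   [e]. *)
pose m := 1 + e + a + b; pose t := e / m.
have a0 : 0 <= a by exact: normr_ge0.
have b0 : 0 <= b by exact: normr_ge0.
have m0 : 0 < m by rewrite /m; lra.
have t0 : 0 < t by rewrite divr_gt0.
have t1 : t < 1 by rewrite ltr_pdivrMr// /m; lra.
have t01 : 0 <= t <= 1 by rewrite !ltW.
have [x' x'E] := simplex_shift x j t01.
have [y' y'E] := simplex_shift y i t01.
exists x', y'; split.
  apply: eV; split=> /=; rewrite -initial_ballE -ball_normE/=.
    rewrite x'E opprD addNKr normrN normrZ gtr0_norm// -/a.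
    by rewrite mulrAC ltr_pdivrMr// ltr_pM2l// /m; lra.
  rewrite y'E opprD addNKr normrN normrZ gtr0_norm// -/b.
  by rewrite mulrAC ltr_pdivrMr// ltr_pM2l// /m; lra.
rewrite (expected_value_shift v x'E) (expected_value_shift v y'E).
by rewrite ler_ltD// ?ltr_pM2l// ler_wpM2l// subr_ge0 ltW.
Qed.

(** * Normalized representing vectors *)

Definition normalized : set 'rV[R]_d :=
  [set v | (forall i, `[0, 1]%classic (v ord0 i)) /\
           exists i j, 1 <= v 0 j - v 0 i].

(** The existential over pairs is a finite union of closed half-spaces. The weak bound [1 <=] makes
    it closed and yet keeps cluster points nonconstant. *)
Lemma compact_normalized : compact normalized.
Proof.
have -> : normalized =
    [set v : 'rV[R]_d | forall i, `[0, 1]%classic (v ord0 i)] `&`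
    \bigcup_(ij in [set: 'I_d * 'I_d])
      (fun v => v 0 ij.2 - v 0 ij.1) @^-1` [set x | 1 <= x].
  apply/seteqP; split=> v [v01 vij]; split=> //; move: vij.
    by move=> [i [j vij]]; exists (i, j).
  by move=> [[i j] _ vij]; exists i, j.
apply: compact_closedI.
  apply: (@rV_compact R d (fun=> `[0, 1]%classic)) => _.
  exact: segment_compact.
apply: closed_bigcup => [|[i j] _]; first exact: finite_finset.
apply: preimage_closed; last exact: closed_ge.
by move=> v _; apply: continuousB; exact: coord_continuous.
Qed.

(** Probabilities sum to 1, so a positive affine change of [v] acts on expected values by the same
    map and preserves the ranking; [w] sends the least coordinate to 0 and the largest to 1. *)
Lemma nonconstant_EU_normalized {B : set (simplex R d * simplex R d)} :
  nonconstant_EU B -> exists v, normalized v /\ forall x y,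
    B (x, y) <-> expected_value v y <= expected_value v x.
Proof.
move=> [[v vB] [x [y [_ nByx]]]].
have vyx : expected_value v y < expected_value v x.
  by rewrite ltNge; apply/negP => /vB.
(* The extrema need an index: with none, the coordinates of [x] would sum to 0. *)
have [k] : exists k : 'I_d, true.
  apply/existsP; apply: contraTT isT => /existsPn d0.
  have := simplex_sum1 x; rewrite big1 => [/esym/eqP|i]; first by rewrite oner_eq0.
  by have := d0 i.
case: (arg_minP (fun i => v 0 i) (i0 := k) (P := xpredT) isT) => i _ imin.
case: (arg_maxP (fun i => v 0 i) (i0 := k) (P := xpredT) isT) => j _ jmax' _.
have jmax l : v 0 l <= v 0 j by exact: jmax'.
pose w := \row_l ((v 0 l - v 0 i) / (v 0 j - v 0 i)).
have wE z : expected_value w z = (expected_value v z - v 0 i) / (v 0 j - v 0 i).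
  rewrite /expected_value -[X in _ - X]mulr1 -(simplex_sum1 z) mulr_sumr -sumrB.
  by rewrite mulr_suml; apply: eq_bigr => l _; rewrite mxE; ring.
(* Were the extrema equal, all alternatives would have the same value, against the strict pair. *)
have vij : 0 < v 0 j - v 0 i.
  rewrite subr_gt0 lt_neqAle imin// andbT; apply/eqP => vij.
  suff vi z : expected_value v z = v 0 i by move: vyx; rewrite !vi ltxx.
  rewrite -[RHS]mulr1 -(simplex_sum1 z) mulr_sumr; apply: eq_bigr => l _.
  by congr (_ * _); apply/le_anti; rewrite imin// andbT vij jmax.
exists w; split.
  split=> [l|]; last first.
    by exists i, j; rewrite !mxE subrr mul0r subr0 divff ?gt_eqF.
  rewrite /= in_itv/= mxE; apply/andP; split.
    by rewrite divr_ge0 ?subr_ge0 ?imin// jmax.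
  by rewrite ler_pdivrMr// mul1r lerB// jmax.
by move=> p q; rewrite vB !wE ler_pM2r ?invr_gt0// lerD2r.
Qed.

Lemma nonconstant_EU_lt {B : set (simplex R d * simplex R d)} {v i j} :
  (forall x y, B (x, y) <-> expected_value v y <= expected_value v x) ->
  v 0 i < v 0 j -> nonconstant_EU B.
Proof.
move=> vB vij; split; first by exists v.
have [p pE] := simplex_vertex j; have [q qE] := simplex_vertex i.
exists p, q; split; first by apply/vB; rewrite pE qE ltW.
by move=> /vB; rewrite pE qE leNgt vij.
Qed.

(** * Closedness, local strictness and limits of expected utility preferences *)

Lemma nonconstant_EU_preference (B : set (simplex R d * simplex R d)) :
  nonconstant_EU B -> preference B.
Proof.
move=> [[v vB] _]; split=> [x y|].
  by have [] := leP (expected_value v y) (expected_value v x);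
    [left|right]; apply/vB => //; exact: ltW.
rewrite -[B]setCK; apply: open_closedC; rewrite openE => -[x y] /= nB.
have vxy : expected_value v x < expected_value v y.
  by rewrite ltNge; apply/negP => /vB.
have [W [U [nW nU WU]]] := near_expected_value_lt vxy.
apply: filterS nU => -[x' y'] U' /vB; apply/negP; rewrite -ltNge.
exact: WU (nbhs_singleton nW) U'.
Qed.

Lemma nonconstant_EU_locally_strict (B : set (simplex R d * simplex R d)) :
  nonconstant_EU B -> locally_strict B.
Proof.
move=> /nonconstant_EU_normalized[v [[_ [i [j vij]]] vB]] x y /vB vyx V nV.
have {}vij : v 0 i < v 0 j by rewrite -subr_gt0 (lt_le_trans ltr01).
have [x' [y' [V' vyx']]] := expected_value_lt_perturb vij vyx nV.
exists x', y'; split=> //; split; first by apply/vB; exact: ltW.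
by move=> /vB; rewrite leNgt vyx'.
Qed.

(* The last two hypotheses on [F] follow both from convergence in the closed
   convergence topology and from sequential closed convergence. *)
Lemma nonconstant_EU_limit (F : set_system (set (simplex R d * simplex R d)))
    (B : set (simplex R d * simplex R d)) : ProperFilter F -> closed B ->
  F (@nonconstant_EU R d) ->
  (forall U, open U -> B `&` U !=set0 -> F [set C | C `&` U !=set0]) ->
  (forall z, ~ B z -> F [set C | ~ C z]) ->
  nonconstant_EU B.
Proof.
move=> FF cB FEU Fhit Fmiss.
(* Off the class [u] is unconstrained; [F] contains the class. *)
have /choice[u uP] : forall C : set (simplex R d * simplex R d),
    exists v, nonconstant_EU C -> normalized v /\ forall x y,
      C (x, y) <-> expected_value v y <= expected_value v x.
  move=> C; have [/nonconstant_EU_normalized[v vP]|nC] :=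
    pselect (nonconstant_EU C); first by exists v.
  by exists 0.
have FS : (u @ F) normalized.
  by apply: (@filterS _ F _ (@nonconstant_EU R d)) FEU => C /uP[].
have [v [[_ [i [j vij]]] clv]] :=
  compact_normalized (u @ F) (fmap_proper_filter u FF) FS.
have {}vij : v 0 i < v 0 j by rewrite -subr_gt0 (lt_le_trans ltr01).
(* Clustering at [v]: any [F]-large property holds for some member of the class whose vector lies in
   [W]. *)
have near_u (P : set (set (simplex R d * simplex R d))) W : F P -> nbhs v W ->
    exists C, [/\ P C, W (u C) & forall x y,
      C (x, y) <-> expected_value (u C) y <= expected_value (u C) x].
  move=> FP nW.
  have FPEU : F (P `&` @nonconstant_EU R d) by exact: filterI.
  have FuP : (u @ F) (u @` (P `&` @nonconstant_EU R d)).
    apply: (@filterS _ F _ (P `&` @nonconstant_EU R d)) FPEU => C PC.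
    by exists C.
  have [_ [[C [PC EUC] <-] WC]] := clv _ _ FuP nW.
  by exists C; split=> //; have [] := uP _ EUC.
apply: (nonconstant_EU_lt (v := v) _ vij) => x y; split=> [Bxy|vyx].
  rewrite leNgt; apply/negP => /near_expected_value_lt[W [U [nW nU WU]]].
  have FU : F [set C | C `&` U° !=set0].
    by apply: Fhit; [exact: open_interior|exists (x, y)].
  have [C [[[x' y'] [Cxy Uxy]] WC CE]] := near_u _ _ FU nW.
  move/CE : Cxy; apply/negP; rewrite -ltNge.
  exact: (WU _ (x', y') WC (interior_subset Uxy)).
(* The pair could be perturbed, staying outside the closed [B], into one ranked strictly by [v];
   some [C] with vector near [v] would both omit and contain it. *)
apply: contrapT => nB.
have nbB : nbhs (x, y) (~` B).
  by apply: open_nbhs_nbhs; split => //; exact: closed_openC.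
have [x' [y' [nB' /near_expected_value_lt[W [U [nW nU WU]]]]]] :=
  expected_value_lt_perturb vij vyx nbB.
have [C [nC WC CE]] := near_u _ _ (Fmiss _ nB') nW.
apply/nC/CE/ltW.
exact: (WU _ (y', x') WC (nbhs_singleton nU)).
Qed.

End ExpectedValue.

(** * The closed convergence topology and sequential limits *)

Lemma open_closed_convergence_subbase {T : topologicalType}
    (A : set (closed_relation T)) : closed_convergence_subbase A -> open A.
Proof.
move=> sA; exists [set A]; last by rewrite bigcup_set1.
move=> _ ->; exists [fset A]%fset; last by rewrite set_fset1 bigcap_set1.
by move=> _ /fset1P ->; exact: mem_set.
Qed.

Lemma not_eventually_subsequence (P : nat -> Prop) :
  ~ (\forall n \near \oo, ~ P n) ->
  exists2 k : nat -> nat, {homo k : m n / (m < n)%N} & forall n, P (k n).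
Proof.
move=> nevP.
have /choice[next nextP] n : exists m, (n < m)%N /\ P m.
  apply: contrapT => nex; apply: nevP; exists n.+1 => // m nm Pm.
  by apply: nex; exists m.
(* Starting from [next 0] rather than 0 makes [P] hold at [k 0] too. *)
pose k n := iter n next (next 0%N).
exists k; last by case=> [|n]; [have [] := nextP 0%N|have [] := nextP (k n)].
by apply: homo_ltn => [m n p|n]; [exact: ltn_trans|have [] := nextP (k n)].
Qed.

Theorem corollary3 (R : realType) (d : nat) (d_ge2 : (2 <= d)%N) :
  (* the set of alternatives *)
  [/\ locally_compact [set: simplex R d],
      separable (simplex R d) &
      completely_metrizable R (simplex R d)] /\
  (* the class is closed in the closed convergence topology ... *)
  closed [set B : closed_relation (simplex R d) | nonconstant_EU B] /\
  (* ... in particular under closed convergence of sequences *)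
  (forall (B_ : nat -> closed_relation (simplex R d))
          (B : closed_relation (simplex R d)),
     (forall n, nonconstant_EU (B_ n)) ->
     closed_convergence (fun n => relation_of (B_ n)) B ->
     nonconstant_EU B) /\
  (* its elements are locally strict preferences *)
  (forall B : set (simplex R d * simplex R d),
     nonconstant_EU B -> preference B /\ locally_strict B).
Proof.
pose k0 : 'I_d := Ordinal (ltnW d_ge2).
have [x0 _] := @simplex_vertex R d k0.
have compactX := compact_set_type (@compact_simplex_set R d).
split; [split|split; [|split]].
- exact: compact_locally_compact.
- exact: compact_separable x0 compactX.
- exact: (@compact_completely_metrizable R (set_type (@simplex_set R d))).
- move=> B clB /=.
  (* Neighborhoods of [B] traced on the class; proper because [B] lies in its closure. *)
  pose F :=
    within [set C : closed_relation (simplex R d) | nonconstant_EU C] (nbhs B).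
  have FF : ProperFilter F by exact: within_nbhs_proper.
  apply: (nonconstant_EU_limit (fmap (@relation_of (simplex R d)) F) B _
    (@closed_relation_of _ B)) => [|U oU BU|z nBz].
  + exact: withinT.
  + apply: (@cvg_within _ (nbhs B) _ _
      [set C : closed_relation (simplex R d) | C `&` U !=set0]).
    apply: open_nbhs_nbhs; split=> //.
    by apply: open_closed_convergence_subbase; left; exists U.
  + suff : nbhs B [set C : closed_relation (simplex R d) | ~ relation_of C z].
      by move=> nz; apply: (@cvg_within _ _ _ _ _ nz).
    (* Omitting [z] is missing the compact set [[set z]], a subbasic open condition. *)
    have -> : [set C : closed_relation (simplex R d) | ~ relation_of C z] =
        [set C : closed_relation (simplex R d) | C `&` [set z] = set0].
      apply/seteqP; split=> C /=.
        by move=> nCz; apply/seteqP; split=> // _ [] /[swap] -> /nCz.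
      by move=> Cz0 Cz; rewrite -[False]/(set0 z) -Cz0.
    apply: open_nbhs_nbhs; split.
      apply: open_closed_convergence_subbase; right; exists [set z] => //.
      exact: compact_set1.
    by apply/seteqP; split=> // _ [] /[swap] -> /nBz.
- move=> B_ B EUB [lim_inf lim_sup].
  apply: (nonconstant_EU_limit ((fun n => relation_of (B_ n)) @ \oo) B _
    (@closed_relation_of _ B)) => [|U oU [z [Bz Uz]]|z nBz].
  + by exists 0%N => // n _; exact: EUB.
  + have [z_ [Bz_ z_z]] := lim_inf z Bz.
    have [N _ NU] := z_z _ (open_nbhs_nbhs (conj oU Uz)).
    by exists N => // n /NU Un; exists (z_ n).
  (* Were [z] in infinitely many [B_ n], the constant sequence along them would force [B z]. *)
  + apply: contrapT => /not_eventually_subsequence[k kmono Bkz].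
    by apply/nBz/(lim_sup k kmono (fun=> z) z Bkz); exact: cvg_cst.
- move=> B EUB; split; first exact: nonconstant_EU_preference.
  exact: nonconstant_EU_locally_strict.
Qed.
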